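(* Let $X_1,\ldots,X_n$ be the observations, with order statistics $X_{(1)}\le\cdots\le X_{(n)}$ and empirical distribution function $\mathbb F_n$. When $\mathbb F_n$ is non-degenerate, the maximum likelihood estimator $(\hat\theta_n,\hat\psi_n)$ of $(\theta_0,\psi_0)$ exists, i.e. there is $(\hat\theta_n,\hat\psi_n)\in\mathbb R\times\mathcal{SC}_0$ maximizing $\Psi_n(\theta,\psi)$ over $\theta\in\mathbb R$, $\psi\in\mathcal{SC}_0$. If $\hat\theta_n$ is unique, then $\hat\theta_n\in[X_{(1)},X_{(n)}]$. Otherwise, one can find at least one maximum likelihood estimator $\hat\theta_n$ with $\hat\theta_n\in[X_{(1)},X_{(n)}]$.
   Context: $\mathcal{SC}_0$ is the class of closed (upper semicontinuous) proper concave functions $\psi:\mathbb R\to[-\infty,\infty)$ that are symmetric about $0$. For $\theta\in\mathbb R$ and $\psi\in\mathcal{SC}_0$, $$\Psi_n(\theta,\psi)=\int_{\mathbb R}\psi(x-\theta)\,d\mathbb F_n(x)-\int_{\mathbb R}e^{\psi(x-\theta)}\,dx .$$ The model is: $X_i$ i.i.d. with density $g_0(\cdot-\theta_0)$, $\theta_0\in\mathbb R$, $g_0$ a log-concave density symmetric about $0$, $\psi_0=\log g_0$; the MLE of $(\theta_0,\psi_0)$ is by definition a maximizer of $\Psi_n$ over $\mathbb R\times\mathcal{SC}_0$ (the second term is a Lagrange term for the normalization $\int e^\psi=1$). $\mathbb F_n$ is degenerate if it puts all its mass on one point. *)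

(* Defs.v *)
From HB Require Import structures.
From mathcomp Require Import all_boot all_order all_algebra.
From mathcomp Require Import all_classical all_reals all_analysis.

Set Implicit Arguments.
Unset Strict Implicit.
Unset Printing Implicit Defensive.

Import Order.TTheory GRing.Theory Num.Theory.
Import numFieldNormedType.Exports.

Local Open Scope classical_set_scope.
Local Open Scope ring_scope.
Local Open Scope ereal_scope.

(* The inequality never meets [-oo + +oo] on functions with values in
   [-oo, +oo[, and [0 * -oo = 0] makes it trivial at [t = 0] and [t = 1]. *)
Definition concave_ereal (R : realType) (psi : R -> \bar R) : Prop :=
  forall (t x y : R), (0 <= t <= 1)%R ->
    t%:E * psi x + (1 - t)%:E * psi y <= psi (t * x + (1 - t) * y)%R.

Definition proper_concave (R : realType) (psi : R -> \bar R) : Prop :=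
  [/\ concave_ereal psi, forall x, psi x < +oo & exists x, -oo < psi x].

Definition upper_semicontinuous (R : realType) (psi : R -> \bar R) : Prop :=
  lower_semicontinuous (fun x => - psi x).

Definition SC0 (R : realType) : set (R -> \bar R) :=
  [set psi | [/\ proper_concave psi, upper_semicontinuous psi
               & forall x : R, psi (- x)%R = psi x]].

(* The probability measure with distribution function F_n. *)
Definition empirical_measure (R : realType) (n : nat) (X : n.-tuple R) :
    {measure set (measurableTypeR R) -> \bar R} :=
  mscale ((n%:R^-1 : R)%:nng)%R
    (msum (fun i : nat => \d_(nth 0%R X i : measurableTypeR R)) n).

Definition degenerate (R : realType) (n : nat) (X : n.-tuple R) : Prop :=
  exists a : R, empirical_measure X [set a] = 1.

(* Indexed from 0: X_(k) is [order_statistic X k.-1]. *)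
Definition order_statistic (R : realType) (n : nat) (X : n.-tuple R)
    (k : nat) : R := nth 0%R (sort <=%R X) k.

(* On SC0 the first integral is < +oo and the second one is >= 0, so the
   difference is never of the form [+oo - +oo]. *)
Definition Psi (R : realType) (n : nat) (X : n.-tuple R)
    (theta : R) (psi : R -> \bar R) : \bar R :=
  \int[empirical_measure X]_x psi (x - theta)%R
  - \int[@lebesgue_measure R]_x expeR (psi (x - theta)%R).

Definition is_mle (R : realType) (n : nat) (X : n.-tuple R)
    (theta : R) (psi : R -> \bar R) : Prop :=
  SC0 psi /\ forall (theta' : R) (psi' : R -> \bar R),
    SC0 psi' -> Psi X theta' psi' <= Psi X theta psi.

Definition is_mle_location (R : realType) (n : nat) (X : n.-tuple R)
    (theta : R) : Prop := exists psi : R -> \bar R, is_mle X theta psi.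

(* Main.v *)
Require Import Defs.
From mathcomp Require Import all_boot all_order all_algebra.
From mathcomp Require Import all_classical all_reals all_analysis measurable_realfun.
From mathcomp Require Import ring lra.
Import Order.TTheory GRing.Theory Num.Theory.
Import numFieldNormedType.Exports.
Local Open Scope ring_scope.

Set Implicit Arguments.
Unset Strict Implicit.
Unset Printing Implicit Defensive.

(** Everything follows from one fact, [mle_between]: some maximizer of the
    criterion has its location between the extreme order statistics.  This gives
    existence, it locates a unique maximizing location, and it is the last
    claim.

    To find that maximizer, the problem is reduced to a finite-dimensional one.
    Fix a location [theta] and put [Y i = |X_i - theta|].  A function [psi] of
    the class enters the criterion through its values [v i] at the [Y i] and
    through the mass of [exp psi].  With the values given, the mass is least for
    the smallest such function, the concave [hull Y v] ([hull_le_SC0]), so the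
    criterion is at most [penalized_mean Y v], the mean of the [v i] minus the
    mass of the hull, and the hull itself attains at least this
    ([penalized_mean_le_Psi_hull]).  Moreover [theta] may be moved into the range
    of the data: clamping it there increases no [|X_i - theta|], hence decreases
    no value at the data, because [psi] is nonincreasing in [|x|], and it leaves
    the mass unchanged by translation invariance ([Psi_le_penalized_mean]).

    It remains to maximize [penalized_mean] over a compact interval of
    locations and all [v].  Two estimates suffice.

    Coercivity ([penalized_mean_coercive]).  As the observations are not all
    equal, one of the [Y i] stays above a fixed [M > 0].  If [c] is the largest
    and [u] the smallest value, the hull is at least [c - 1] for
    [|x| <= M / (1 + c - u)], so the mass is at least of order
    [exp c / (1 + c - u)].  A lower bound on the penalized mean bounds [c - u]
    by a multiple of [c] plus a constant, and the exponential then bounds [c].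

    Continuity ([hull_mass_lipschitz]).  Two knots [Y i] may merge while their
    values stay apart, so the slopes of the hull are unbounded, and the hull does
    not depend on the data uniformly in [x].  But lowering all knots and values
    by [d] turns the hull [h] into [h (|x| + d) - d], which changes the mass by
    [O(d)] only, whatever the slopes.  Together with monotonicity this makes the
    mass Lipschitz on boxes, and the extreme value theorem applies. *)

(** * Symmetric concave functions *)

Lemma SC0_normr (R : realType) (psi : R -> \bar R) (x : R) : SC0 psi ->
  psi x = psi `|x|.
Proof. by move=> [_ _ sym]; case: (ger0P x). Qed.

(** If [psi y] is finite, [x] lies between [-y] and [y], where [psi] takes the
    same value; concavity does the rest. *)
Lemma SC0_nonincreasing (R : realType) (psi : R -> \bar R) (x y r : R) : SC0 psi ->
  `|x| <= `|y| -> psi y = r%:E -> (psi y <= psi x)%E.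
Proof.
move=> S xy yr; rewrite (SC0_normr x S) (SC0_normr y S).
rewrite (SC0_normr y S) in yr.
have [[conc _ _] _ sym] := S.
have [y0|y0] := eqVneq `|y| 0.
  by rewrite y0 in xy *; have -> : `|x| = 0 by apply/eqP; rewrite eq_le xy normr_ge0.
have yp : 0 < `|y| by rewrite lt_def y0 normr_ge0.
set t := (1 + `|x| / `|y|) / 2.
have q0 : 0 <= `|x| / `|y| by rewrite divr_ge0.
have q1 : `|x| / `|y| <= 1 by rewrite ler_pdivrMr// mul1r.
have : 0 <= t <= 1 by rewrite /t; lra.
move=> /(conc _ `|y| (- `|y|)); rewrite sym yr.
have -> : t * `|y| + (1 - t) * - `|y| = `|x| by rewrite /t; field.
by rewrite -!EFinM -EFinD; congr (_ <= _)%E; congr EFin; ring.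
Qed.

(** * The symmetric concave hull of finitely many values *)

Section Hull.
Local Open Scope classical_set_scope.

(** A pair [(al, be)] stands for the function [al - be * |x|]. *)
Definition majorant (R : realType) (n : nat) (Y v : 'I_n -> R) : set (R * R) :=
  [set p | 0 <= p.2 /\ forall i, v i + p.2 * Y i <= p.1].

(** For nonnegative [Y i], the smallest function of the class above [v i] at
    each [Y i].  Writing it as an infimum makes concavity and semicontinuity
    immediate, and gives the value [-oo] beyond the largest knot, where
    arbitrarily steep majorants are available. *)
Definition hull (R : realType) (n : nat) (Y v : 'I_n -> R) (x : R) : \bar R :=
  ereal_inf [set (p.1 - p.2 * `|x|)%:E | p in majorant Y v].

Lemma hull_le (R : realType) n (Y v : 'I_n -> R) (al be x : R) :
  0 <= be -> (forall i, v i + be * Y i <= al) ->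
  (hull Y v x <= (al - be * `|x|)%:E)%E.
Proof. by move=> be0 H; apply: ereal_inf_lbound; exists (al, be). Qed.

Lemma le_hull (R : realType) n (Y v : 'I_n -> R) (r : \bar R) (x : R) :
  (forall al be, 0 <= be -> (forall i, v i + be * Y i <= al) ->
    (r <= (al - be * `|x|)%:E)%E) -> (r <= hull Y v x)%E.
Proof. by move=> H; apply: le_ereal_inf_tmp => _ [[al be] [/= ? ?] <-]; exact: H. Qed.

Lemma hull_lt (R : realType) n (Y v : 'I_n -> R) (r : \bar R) (x : R) :
  (hull Y v x < r)%E -> exists al be, [/\ 0 <= be,
    forall i, v i + be * Y i <= al & ((al - be * `|x|)%:E < r)%E].
Proof.
by move=> /ereal_inf_lt[_ [[al be] [/= ? ?] <-] ?]; exists al, be.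
Qed.

Lemma le_hull_knot (R : realType) n (Y v : 'I_n -> R) (i : 'I_n) (x : R) :
  `|x| = Y i -> ((v i)%:E <= hull Y v x)%E.
Proof.
move=> xi; apply: le_hull => al be _ /(_ i); rewrite lee_fin xi; lra.
Qed.

Lemma hull_le_cst (R : realType) n (Y v : 'I_n -> R) (C x : R) :
  (forall i, v i <= C) -> (hull Y v x <= C%:E)%E.
Proof.
move=> vC; apply: le_trans (hull_le (al := C) (be := 0) x _ _) _ => //.
  by move=> i; rewrite mul0r addr0.
by rewrite mul0r subr0.
Qed.

Lemma hull_outside (R : realType) n (Y v : 'I_n -> R) (C W x : R) :
  (forall i, v i <= C) -> (forall i, Y i <= W) -> W < `|x| ->
  hull Y v x = -oo%E.
Proof.
move=> vC YW Wx; apply: eq_ninfty => A.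
set be := `|C - A| / (`|x| - W).
have be0 : 0 <= be by rewrite divr_ge0// subr_ge0 ltW.
apply: le_trans (hull_le (al := C + be * W) x be0 _) _.
  by move=> i; rewrite lerD// ler_wpM2l.
have : be * (`|x| - W) = `|C - A|.
  by rewrite divfK// gt_eqF// subr_gt0.
rewrite lee_fin => E; have := ler_norm (C - A); nra.
Qed.

Lemma concave_hull (R : realType) n (Y v : 'I_n -> R) : concave_ereal (hull Y v).
Proof.
move=> t x y /andP[t0 t1]; apply: le_hull => al be be0 H.
apply: (@le_trans _ _ (t%:E * (al - be * `|x|)%:E + (1 - t)%:E * (al - be * `|y|)%:E)%E).
  by apply: leeD; apply: lee_wpmul2l; rewrite ?lee_fin ?subr_ge0//; exact: hull_le.
rewrite -!EFinM -EFinD lee_fin.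
have : `|t * x + (1 - t) * y| <= t * `|x| + (1 - t) * `|y|.
  apply: le_trans (ler_normD _ _) _.
  by rewrite !normrM (ger0_norm t0) (@ger0_norm _ (1 - t)) ?subr_ge0.
nra.
Qed.

Lemma upper_semicontinuous_hull (R : realType) n (Y v : 'I_n -> R) :
  upper_semicontinuous (hull Y v).
Proof.
move=> x a; rewrite lteNr -EFinN => /hull_lt[al [be [be0 H]]]; rewrite lte_fin => xa.
exists [set y | al - be * `|y| < - a].
  have : (fun y : R => al - be * `|y|) @ x --> (al - be * `|x|).
    apply: cvgB; first exact: cvg_cst.
    by apply: cvgM; [exact: cvg_cst|exact: norm_continuous].
  by move=> /cvgrPdist_lt/(_ (- a - (al - be * `|x|))); rewrite subr_gt0 => /(_ xa);
     apply: filterS => y /=; rewrite distrC => /(le_lt_trans (ler_norm _)); lra.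
move=> y /= ya; rewrite lteNr -EFinN.
by apply: le_lt_trans (hull_le y be0 H) _; rewrite lte_fin.
Qed.

Lemma SC0_hull (R : realType) n (Y v : 'I_n -> R) (i : 'I_n) :
  0 <= Y i -> SC0 (hull Y v).
Proof.
move=> Yi0; split; [split | exact: upper_semicontinuous_hull | by move=> x; rewrite /hull normrN].
- exact: concave_hull.
- move=> x; apply: (@le_lt_trans _ _ (\sum_j `|v j|)%:E); last exact: ltry.
  apply: hull_le_cst => j; apply: le_trans (ler_norm _) _.
  by rewrite (bigD1 j)//= lerDl sumr_ge0.
- exists (Y i); apply: lt_le_trans (le_hull_knot _ (i := i) _); first exact: ltNyr.
  exact: ger0_norm.
Qed.

(** To bound the hull at [x] by [r >= psi x], a majorant through [(x, r)] is
    needed, that is, a slope compatible with all knots; it exists because the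
    chords of [psi] on the left of [x] are flatter than those on the right. *)
Lemma hull_le_SC0 (R : realType) n (Y v : 'I_n -> R) (psi : R -> \bar R) :
  SC0 psi -> (forall i, 0 <= Y i) -> (forall i, psi (Y i) = (v i)%:E) ->
  forall x, (hull Y v x <= psi x)%E.
Proof.
move=> S Y0 psiv x; rewrite (SC0_normr x S).
have -> : hull Y v x = hull Y v `|x| by rewrite /hull normr_id.
move: (normr_ge0 x); move: {x}(`|x|) => x x0.
have [[conc fin _] _ _] := S.
suff H r : (psi x <= r%:E)%E -> (hull Y v x <= r%:E)%E.
  case E : (psi x) => [r| |]; first by apply: H; rewrite E.
    exact: leey.
  suff -> : hull Y v x = -oo%E by [].
  by apply: eq_ninfty => A; apply: H; rewrite E leNye.
move=> psir.
(* The least nonnegative slope that keeps [r + be * (x - |.|)] above the knots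
   on the left of [x]; concavity makes it small enough for those on the right. *)
pose be := \big[Num.max/0]_(i | Y i < x) ((v i - r) / (x - Y i)).
have be0 : 0 <= be by rewrite /be bigmax_ge_id.
apply: le_trans (hull_le (al := r + be * x) x be0 _) _; last first.
  by rewrite ger0_norm// addrK.
move=> i.
have [Yx|xY|Yx] := ltgtP (Y i) x.
- have : (v i - r) / (x - Y i) <= be by rewrite /be; apply: le_bigmax_cond.
  by rewrite ler_pdivrMr ?subr_gt0//; lra.
- have : be <= (r - v i) / (Y i - x).
    rewrite /be; apply: bigmax_le.
      apply: divr_ge0; rewrite subr_ge0; last exact: ltW.
      rewrite -lee_fin -psiv; apply: le_trans psir.
      by apply: SC0_nonincreasing (psiv i) => //; rewrite !ger0_norm// ltW.
    move=> j jx; rewrite ler_pdivrMr ?subr_gt0// mulrAC ler_pdivlMr ?subr_gt0//.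
    have d0 : 0 < Y i - Y j by rewrite subr_gt0; exact: lt_trans jx xY.
    set t := (Y i - x) / (Y i - Y j).
    have t01 : 0 <= t <= 1.
      by rewrite /t ler_pdivlMr// ler_pdivrMr//; apply/andP; split; lra.
    have := conc _ (Y j) (Y i) t01.
    have -> : t * Y j + (1 - t) * Y i = x by rewrite /t; field; rewrite gt_eqF.
    rewrite !psiv -!EFinM -EFinD => /le_trans/(_ psir); rewrite lee_fin.
    have -> : t * v j + (1 - t) * v i = ((Y i - x) * v j + (x - Y j) * v i) / (Y i - Y j).
      by rewrite /t; field; rewrite gt_eqF.
    rewrite ler_pdivrMr//; lra.
  by rewrite ler_pdivlMr ?subr_gt0//; lra.
- have : v i <= r by rewrite -lee_fin -psiv Yx.
  rewrite Yx; lra.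
Qed.

(** A majorant of the data [Y', v'] becomes one of [Y, v] when it is moved by
    [d] both upwards and away from the origin. *)
Lemma hull_shift (R : realType) n (Y v Y' v' : 'I_n -> R) (d x : R) :
  (forall i, Y i - d <= Y' i) -> (forall i, v i - d <= v' i) -> d <= `|x| ->
  (hull Y v x <= hull Y' v' (`|x| - d) + d%:E)%E.
Proof.
move=> YY vv dx; rewrite -leeBlDr//; apply: le_hull => al be be0 H.
rewrite leeBlDr//; apply: le_trans (hull_le (al := al + d + be * d) x be0 _) _.
  move=> i; have := H i; have := vv i.
  have : be * (Y i - d) <= be * Y' i by rewrite ler_wpM2l.
  by rewrite mulrBr; lra.
by rewrite -EFinD lee_fin (@ger0_norm _ (`|x| - d)) ?subr_ge0//; lra.
Qed.

(** The hull lies above the segment from [(0, v i)] to [(M, u)], which descends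
    by [v i - u] over the length [M]. *)
Lemma hull_ge_top (R : realType) n (Y v : 'I_n -> R) (i j : 'I_n) (u M x : R) :
  (forall k, 0 <= Y k) -> u <= v i -> u <= v j -> M <= Y j ->
  `|x| * (1 + v i - u) <= M -> ((v i - 1)%:E <= hull Y v x)%E.
Proof.
move=> Y0 ui uj Mj xM; apply: le_hull => al be be0 H; rewrite lee_fin.
set s := (1 + v i - u)^-1.
have sp : 0 < 1 + v i - u by lra.
have s0 : 0 < s by rewrite invr_gt0.
have s1 : s * (1 + v i - u) = 1 by rewrite mulVf// gt_eqF.
have sle : s <= 1 by nra.
have xs : `|x| <= s * M by rewrite /s mulrC ler_pdivlMr.
have Hi := H i; have Hj := H j; have Yi := Y0 i.
(* The constraints at [i] and [j], combined with weights [1 - s] and [s]. *)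
have A : (1 - s) * v i + s * u + be * (s * M) <= al.
  have : (1 - s) * (v i + be * Y i) + s * (v j + be * Y j) <= al by nra.
  have : 0 <= (1 - s) * (be * Y i) by rewrite !mulr_ge0// subr_ge0.
  have : s * (v j - u) >= 0 by rewrite mulr_ge0// ?subr_ge0// ltW.
  have : (s * be) * (Y j - M) >= 0 by rewrite !mulr_ge0// ?subr_ge0// ltW.
  nra.
have : be * `|x| <= be * (s * M) by rewrite ler_wpM2l.
nra.
Qed.

End Hull.

(** * Integrals with respect to Lebesgue measure *)

Section Integrals.
Local Open Scope classical_set_scope.
Local Open Scope ereal_scope.
Local Notation mu := (@lebesgue_measure _).

Lemma measurable_usc (R : realType) (psi : R -> \bar R) :
  upper_semicontinuous psi -> measurable_fun setT psi.
Proof.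
move=> /lower_semicontinuous_measurable m.
rewrite (_ : psi = (fun x => - (- psi x))); first exact: measurableT_comp.
by apply/funext => x; rewrite oppeK.
Qed.

Lemma measurable_expeR_usc (R : realType) (psi : R -> \bar R) :
  upper_semicontinuous psi -> measurable_fun setT (fun x => expeR (psi x)).
Proof.
move=> usc; apply: measurable_usc => x a.
rewrite lteNr -EFinN => xa.
have a0 : (0 < - a)%R by rewrite -lte_fin; apply: le_lt_trans xa; exact: expeR_ge0.
have E : (- a)%:E = expeR (ln (- a))%:E by rewrite /= lnK.
move: xa; rewrite E lte_expeR => xa.
have [V Vx HV] : exists2 V, nbhs x V & forall y, V y -> (- ln (- a))%:E < - psi y.
  by apply: usc; rewrite lteNr -EFinN opprK.
exists V => // y /HV; rewrite lteNr -EFinN opprK -lte_expeR -E => ya.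
by rewrite lteNr -EFinN.
Qed.

Lemma integral_translate (R : realType) (f : R -> \bar R) (t : R) :
  measurable_fun setT f -> (forall x, 0 <= f x) ->
  \int[mu]_x f (x - t)%R = \int[mu]_x f x.
Proof.
move=> mf f0.
pose phi : measurableTypeR R -> measurableTypeR R := fun x => (x - t)%R.
have mphi : measurable_fun setT phi by exact: measurable_funB.
transitivity (\int[pushforward mu phi]_(y in setT) f y).
  by rewrite (ge0_integral_pushforward mphi).
apply: eq_measure_integral => //= A mA _; apply/esym/lebesgue_measure_unique => //.
move=> _ [[a b]] _ <-; rewrite /= /pushforward.
rewrite (_ : phi @^-1` _ = `](a + t)%R, (b + t)%R]%classic); last first.
  by apply/seteqP; split => x /=; rewrite !in_itv/= /phi ltrBrDr lerBlDr.
by rewrite !lebesgue_measure_itv/= !lte_fin ltrD2r -!EFinD; case: ifPn => // _;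
  congr EFin; ring.
Qed.

Lemma measurable_patch_cst (R : realType) (c w : R) :
  measurable_fun setT ((cst c%:E : R -> \bar R) \_ `[(- w)%R, w]).
Proof.
exact: (iffLR (measurable_restrictT _ (measurable_itv _)) (measurable_cst _)).
Qed.

Lemma integral_plateau (R : realType) (c w : R) : (0 <= w)%R ->
  \int[mu]_x ((cst c%:E : R -> \bar R) \_ `[(- w)%R, w]) x = (c * (2 * w))%:E.
Proof.
move=> w0; rewrite -integral_mkcond integral_cst//= lebesgue_measure_itv/= lte_fin.
case: ifPn => [_|].
  by rewrite -EFinD -EFinM; congr EFin; ring.
rewrite -leNgt => ww; have -> : w = 0%R by lra.
by rewrite mule0 !mulr0.
Qed.

Lemma patch_plateau (R : realType) (c w x : R) :
  ((cst c%:E : R -> \bar R) \_ `[(- w)%R, w]) x = if (`|x| <= w)%R then c%:E else 0.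
Proof. by rewrite patchE mem_setE in_itv/= ler_norml. Qed.

Lemma integral_le_plateau (R : realType) (f : R -> \bar R) (c w : R) :
  measurable_fun setT f -> (forall x, 0 <= f x) -> (0 <= c)%R -> (0 <= w)%R ->
  (forall x, f x <= c%:E) -> (forall x, (w < `|x|)%R -> f x = 0) ->
  \int[mu]_x f x <= (c * (2 * w))%:E.
Proof.
move=> mf f0 c0 w0 fc fw; rewrite -integral_plateau//.
apply: ge0_le_integral => //.
- exact: measurable_patch_cst.
- by move=> x _; rewrite patch_plateau; case: (leP `|x|%R _) => [_|xw]; [exact: fc|rewrite fw//].
Qed.

Lemma integral_ge_plateau (R : realType) (f : R -> \bar R) (c w : R) :
  measurable_fun setT f -> (forall x, 0 <= f x) -> (0 <= c)%R -> (0 <= w)%R ->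
  (forall x, (`|x| <= w)%R -> c%:E <= f x) ->
  (c * (2 * w))%:E <= \int[mu]_x f x.
Proof.
move=> mf f0 c0 w0 fc; rewrite -integral_plateau//.
apply: ge0_le_integral => //.
- by move=> x _; rewrite patch_plateau; case: ifP => // _; rewrite lee_fin.
- exact: measurable_patch_cst.
- by move=> x _; rewrite patch_plateau; case: (leP `|x|%R _) => [xw|_]; [exact: fc|].
Qed.

(** Outside [[-d, d]], [f] is dominated by [k] times the two halves of [g],
    moved apart by [d]; a translation restores the mass of each half. *)
Lemma integral_spread (R : realType) (f g : R -> \bar R) (c d k : R) :
  measurable_fun setT f -> (forall x, 0 <= f x) ->
  measurable_fun setT g -> (forall x, 0 <= g x) ->
  (forall x, g (- x)%R = g x) -> (0 <= c)%R -> (0 <= d)%R -> (0 <= k)%R ->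
  (forall x, f x <= c%:E) ->
  (forall x, (d <= `|x|)%R -> f x <= k%:E * g (`|x| - d)%R) ->
  \int[mu]_x f x <= (c * (2 * d))%:E + k%:E * \int[mu]_x g x.
Proof.
move=> mf f0 mg g0 gN c0 d0 k0 fc fg.
pose gp : R -> \bar R := g \_ `[0%R, +oo[; pose gn : R -> \bar R := g \_ `]-oo, 0%R[.
have gpE (x : R) : gp x = if (0 <= x)%R then g x else 0.
  by rewrite /gp patchE mem_setE in_itv/= andbT.
have gnE (x : R) : gn x = if (x < 0)%R then g x else 0.
  by rewrite /gn patchE mem_setE in_itv/=.
have gp0 (x : R) : 0 <= gp x by rewrite gpE; case: ifP.
have gn0 (x : R) : 0 <= gn x by rewrite gnE; case: ifP.
have mgp : measurable_fun setT gp.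
  apply: (iffLR (measurable_restrictT _ (measurable_itv _))).
  exact: measurable_funTS.
have mgn : measurable_fun setT gn.
  apply: (iffLR (measurable_restrictT _ (measurable_itv _))).
  exact: measurable_funTS.
have mtr (h : R -> \bar R) (t : R) : measurable_fun setT h ->
    measurable_fun setT (fun x : R => h (x - t)%R).
  by move=> mh; apply: measurableT_comp => //; exact: measurable_funB.
have -> : \int[mu]_x g x = \int[mu]_x gp (x - d)%R + \int[mu]_x gn (x - (- d))%R.
  rewrite !integral_translate// -ge0_integralD//.
  apply: eq_integral => x _; rewrite gpE gnE leNgt.
  by case: (x < 0)%R; rewrite /= ?add0e ?adde0.
rewrite -ge0_integralD//; last 2 first.
  exact: mtr.
  exact: mtr.
rewrite -ge0_integralZl//; last 2 first.
- by apply: emeasurable_funD; exact: mtr.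
- by move=> x _; exact: adde_ge0.
rewrite -integral_plateau// -ge0_integralD//; last 4 first.
- by move=> x _; rewrite patch_plateau; case: ifP => // _; rewrite lee_fin.
- exact: measurable_patch_cst.
- by move=> x _; apply: mule_ge0; rewrite ?lee_fin//; exact: adde_ge0.
- by apply: measurable_funeM; apply: emeasurable_funD; exact: mtr.
apply: ge0_le_integral => //.
  apply: emeasurable_funD; first exact: measurable_patch_cst.
  by apply: measurable_funeM; apply: emeasurable_funD; exact: mtr.
move=> x _; rewrite patch_plateau.
case: (leP `|x|%R _) => [_|dx].
  apply: le_trans (fc x) _; rewrite leeDl//.
  by apply: mule_ge0; rewrite ?lee_fin//; exact: adde_ge0.
rewrite add0e; apply: le_trans (fg _ (ltW dx)) _.
rewrite lee_wpmul2l ?lee_fin//.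
have [x0|x0] := leP 0%R x.
  rewrite ger0_norm// in dx *.
  by rewrite gpE subr_ge0 (ltW dx) leeDl.
rewrite ltr0_norm// in dx *.
rewrite gnE opprK ifT; last lra.
by rewrite -[X in X <= _]gN opprB opprK addrC leeDr.
Qed.

End Integrals.

(** * Integrals with respect to the empirical measure *)

Section Empirical.
Local Open Scope classical_set_scope.

Lemma ge0_integral_empirical (R : realType) (n : nat) (X : n.-tuple R) (f : R -> \bar R) :
  measurable_fun setT f -> (forall x, 0 <= f x)%E ->
  (\int[empirical_measure X]_x f x = (n%:R^-1)%:E * \sum_(i < n) f (tnth X i))%E.
Proof.
move=> mf f0.
rewrite /empirical_measure ge0_integral_mscale//; congr (_ * _)%E.
rewrite ge0_integral_measure_sum//; apply: eq_bigr => i _.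
by rewrite integral_dirac// diracT mul1e (tnth_nth 0).
Qed.

Lemma integral_empirical (R : realType) (n : nat) (X : n.-tuple R)
    (f : R -> \bar R) (v : 'I_n -> R) :
  measurable_fun setT f -> (forall i, f (tnth X i) = (v i)%:E) ->
  (\int[empirical_measure X]_x f x = (n%:R^-1 * \sum_i v i)%:E)%E.
Proof.
move=> mf fv; rewrite integralE !ge0_integral_empirical//; last 2 first.
- exact: measurable_funeneg.
- exact: measurable_funepos.
under eq_bigr do rewrite funeposE fv -EFin_max.
under [in X in (_ - X)%E]eq_bigr do rewrite funenegE fv -EFinN -EFin_max.
rewrite !sumEFin -!EFinM -EFinB -mulrBr -sumrB; congr (_ * _)%:E.
by apply: eq_bigr => i _; rewrite /Num.max; do 2 case: ifP; lra.
Qed.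

Lemma integral_empiricalNy (R : realType) (n : nat) (X : n.-tuple R)
    (f : R -> \bar R) (i : 'I_n) :
  measurable_fun setT f -> f (tnth X i) = -oo%E ->
  (\int[empirical_measure X]_x f x = -oo)%E.
Proof.
move=> mf fi; rewrite integralE [X in (_ - X)%E](_ : _ = +oo%E) ?addeNy//.
rewrite ge0_integral_empirical//; last exact: measurable_funeneg.
have n0 : (0 < n)%N by exact: leq_ltn_trans (leq0n _) (ltn_ord i).
rewrite (_ : (\sum_(j < n) _)%E = +oo%E); first by rewrite gt0_muley// lte_fin invr_gt0 ltr0n.
apply/esum_eqyP; first by move=> j _; rewrite gt_eqF// (lt_le_trans _ (funeneg_ge0 _ _)).
by exists i; split => //; rewrite funenegE fi.
Qed.

End Empirical.

(** * The mass of the hull *)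

Section HullMass.
Local Open Scope classical_set_scope.
Local Notation mu := (@lebesgue_measure _).

Definition hull_mass (R : realType) (n : nat) (Y v : 'I_n -> R) : R :=
  fine (\int[mu]_x expeR (hull Y v x))%E.

Lemma hull_mass_bound (R : realType) n (Y v : 'I_n -> R) (C W : R) : 0 <= W ->
  (forall i, v i <= C) -> (forall i, Y i <= W) ->
  (\int[mu]_x expeR (hull Y v x) <= (expR C * (2 * W))%:E)%E.
Proof.
move=> W0 vC YW; apply: integral_le_plateau => //.
- by apply: measurable_expeR_usc; exact: upper_semicontinuous_hull.
- by move=> x; exact: expeR_ge0.
- by move=> x; rewrite -[(expR C)%:E]/(expeR C%:E) lee_expeR; exact: hull_le_cst.
- by move=> x Wx; rewrite (hull_outside vC YW Wx).
Qed.

Lemma hull_massE (R : realType) n (Y v : 'I_n -> R) :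
  ((hull_mass Y v)%:E = \int[mu]_x expeR (hull Y v x))%E.
Proof.
have le_sum (f : 'I_n -> R) i : f i <= \sum_j `|f j|.
  apply: le_trans (ler_norm _) _.
  by rewrite (bigD1 i)//= lerDl sumr_ge0.
rewrite /hull_mass fineK// ge0_fin_numE; last by apply: integral_ge0 => x _; exact: expeR_ge0.
apply: le_lt_trans (hull_mass_bound _ (le_sum v) (le_sum Y)) _; last exact: ltry.
exact: sumr_ge0.
Qed.

Lemma hull_mass_ge0 (R : realType) n (Y v : 'I_n -> R) : 0 <= hull_mass Y v.
Proof. by apply: fine_ge0; apply: integral_ge0 => x _; exact: expeR_ge0. Qed.

Lemma hull_mass_le (R : realType) n (Y v : 'I_n -> R) (C W : R) : 0 <= W ->
  (forall i, v i <= C) -> (forall i, Y i <= W) ->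
  hull_mass Y v <= expR C * (2 * W).
Proof. by move=> ? ? ?; rewrite -lee_fin hull_massE hull_mass_bound. Qed.

(** The factor [expR d] pays for the change of the values, the additive term
    for the change of the knots. *)
Lemma hull_mass_shift (R : realType) n (Y v Y' v' : 'I_n -> R) (C d : R) : 0 <= d ->
  (forall i, v i <= C) ->
  (forall i, Y i - d <= Y' i) -> (forall i, v i - d <= v' i) ->
  hull_mass Y v <= expR C * (2 * d) + expR d * hull_mass Y' v'.
Proof.
move=> d0 vC YY vv; rewrite -lee_fin EFinD (EFinM (expR d)) !hull_massE.
apply: integral_spread => //.
- by apply: measurable_expeR_usc; exact: upper_semicontinuous_hull.
- by move=> x; exact: expeR_ge0.
- by apply: measurable_expeR_usc; exact: upper_semicontinuous_hull.
- by move=> x; exact: expeR_ge0.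
- by move=> x; rewrite /hull normrN.
- by move=> x; rewrite -[(expR C)%:E]/(expeR C%:E) lee_expeR; exact: hull_le_cst.
- move=> x dx; rewrite -[(expR d)%:E]/(expeR d%:E) -expeRD lee_expeR addeC.
  exact: hull_shift.
Qed.

Lemma hull_mass_ge (R : realType) n (Y v : 'I_n -> R) (i j : 'I_n) (u M : R) :
  (forall k, 0 <= Y k) -> (forall k, u <= v k) -> 0 <= M -> M <= Y j ->
  expR (v i - 1) * (2 * (M / (1 + v i - u))) <= hull_mass Y v.
Proof.
move=> Y0 uv M0 Mj; have p : 0 < 1 + v i - u by have := uv i; lra.
rewrite -lee_fin hull_massE; apply: integral_ge_plateau => //.
- by apply: measurable_expeR_usc; exact: upper_semicontinuous_hull.
- by move=> x; exact: expeR_ge0.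
- by rewrite divr_ge0// ltW.
- move=> x xM; rewrite -[(expR _)%:E]/(expeR (v i - 1)%:E) lee_expeR.
  by apply: (hull_ge_top (j := j) (u := u) (M := M)) => //; rewrite -ler_pdivlMr.
Qed.

(** The bound on [d] serves to replace [expR d - 1] by [2 * d].  Exchanging the
    two sets of data bounds the difference from the other side. *)
Lemma hull_mass_lipschitz (R : realType) n (Y v Y' v' : 'I_n -> R) (C W d : R) :
  0 <= W -> 0 <= d <= 2^-1 ->
  (forall i, v i <= C) -> (forall i, v' i <= C) -> (forall i, Y' i <= W) ->
  (forall i, Y i - d <= Y' i) -> (forall i, v i - d <= v' i) ->
  hull_mass Y v - hull_mass Y' v' <= d * (2 * expR C * (1 + 2 * W)).
Proof.
move=> W0 /andP[d0 d1] vC v'C Y'W YY vv.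
have := hull_mass_shift d0 vC YY vv.
have := hull_mass_le W0 v'C Y'W.
have := hull_mass_ge0 Y' v'.
move: (hull_mass Y v) (hull_mass Y' v') => J J' J'0 J'C JJ.
have ed : expR d - 1 <= 2 * d.
  have : (1 - d) * expR d <= 1.
    have := expR_ge1Dx (- d); rewrite expRN => H.
    rewrite -ler_pdivlMr ?expR_gt0// mul1r; lra.
  have := expR_ge1Dx d; nra.
have := expR_gt0 C => C0.
have : (expR d - 1) * J' <= 2 * d * (expR C * (2 * W)).
  apply: le_trans (_ : 2 * d * J' <= _); first by rewrite ler_wpM2r.
  by rewrite ler_wpM2l// mulr_ge0.
nra.
Qed.

(** Any growth faster than quadratic suffices in [penalized_mean_coercive]. *)
Lemma expR_ge_cube (R : realType) (t : R) : 0 <= t -> t ^+ 3 / 27 <= expR t.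
Proof.
move=> t0; have -> : expR t = expR (t / 3) ^+ 3.
  by rewrite -expRM_natl; congr expR; field.
have : t / 3 <= expR (t / 3) by have := expR_ge1Dx (t / 3); lra.
have -> : t ^+ 3 / 27 = (t / 3) ^+ 3 by field.
by move=> ?; rewrite lerXn2r// nnegrE ?expR_ge0// divr_ge0.
Qed.

Definition penalized_mean (R : realType) n (Y v : 'I_n -> R) : R :=
  n%:R^-1 * \sum_i v i - hull_mass Y v.

(** In terms of [t = c - F0], with [c] the largest value, the mass is at most
    [t] since the mean is at most [c], and all values are at least [c - n * t].
    Then [hull_mass_ge] reads [K * expR t <= t * (1 + n * t)], which bounds
    [t]. *)
Lemma penalized_mean_coercive (R : realType) n (M F0 : R) : (0 < n)%N -> 0 < M ->
  exists m C, forall Y v : 'I_n -> R, (forall k, 0 <= Y k) -> (exists j, M <= Y j) ->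
    F0 <= penalized_mean Y v -> forall k, m <= v k <= C.
Proof.
move=> n0 M0; set K := 2 * M * expR (F0 - 1).
have K0 : 0 < K by rewrite /K !mulr_gt0// expR_gt0.
have N0 : 0 < n%:R :> R by rewrite ltr0n.
set N : R := n%:R in N0 *.
set T := 1 + 27 * (N + 1) / K.
exists (F0 - N * T), (F0 + T) => Y v Y0 [j Mj] HF k.
have [i _ imax] : exists2 i, true & forall l, v l <= v i.
  have [i _ Hi] := @arg_maxP _ _ 'I_n (Ordinal n0) xpredT v isT.
  by exists i => // l; exact: Hi.
set c := v i in imax *; set t := c - F0.
have J0 := hull_mass_ge0 Y v.
have sumv : N * F0 + N * hull_mass Y v <= \sum_i v i.
  move: HF; rewrite /penalized_mean -/N -(ler_pM2l N0) mulrBr mulrA divff ?gt_eqF// mul1r.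
  lra.
have sumc : \sum_i v i <= N * c.
  rewrite /N mulr_natl -[X in _ *+ X]card_ord -sumr_const.
  by apply: ler_sum.
have JT : hull_mass Y v <= t.
  have : N * hull_mass Y v <= N * t by rewrite /t; lra.
  by rewrite ler_pM2l.
have t0 : 0 <= t by exact: le_trans JT.
set u := c - N * t.
have uv l : u <= v l.
  have : \sum_i v i <= v l + (N - 1) * c.
    rewrite (bigD1 l)//= lerD2l.
    apply: le_trans (ler_sum _ (fun i _ => imax i)) _.
    rewrite sumr_const cardC1 card_ord -mulr_natl.
    by rewrite -subn1 natrB.
  have : 0 <= N * hull_mass Y v by rewrite mulr_ge0// ltW.
  rewrite /u /t; lra.
have := hull_mass_ge i Y0 uv (ltW M0) Mj; rewrite -/c.
have -> : 1 + c - u = 1 + N * t by rewrite /u; ring.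
have p : 0 < 1 + N * t by have : 0 <= N * t := mulr_ge0 (ltW N0) t0; lra.
have -> : expR (c - 1) * (2 * (M / (1 + N * t))) = K * expR t / (1 + N * t).
  have -> : c - 1 = F0 - 1 + t by rewrite /t; ring.
  by rewrite expRD /K; field; rewrite gt_eqF.
rewrite ler_pdivrMr// => HJ.
have cube : K * (t ^+ 3 / 27) <= t * (1 + N * t).
  apply: le_trans (_ : K * expR t <= _); first by rewrite ler_pM2l// expR_ge_cube.
  by apply: le_trans HJ _; rewrite ler_wpM2r// ltW.
have tT : t <= T.
  rewrite leNgt; apply/negP => Tt.
  have q0 : 0 < 27 * (N + 1) / K by rewrite divr_gt0//; lra.
  have t1 : 1 < t by rewrite /T in Tt; lra.
  have Kt : 27 * (N + 1) < K * t.
    have : 27 * (N + 1) / K < t by rewrite /T in Tt; lra.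
    by rewrite ltr_pdivrMr// (mulrC K).
  have tt : 0 < t ^+ 2 by rewrite exprn_gt0//; lra.
  have : 27 * (N + 1) * t ^+ 2 < K * t * t ^+ 2 by rewrite ltr_pM2r.
  have : t <= t ^+ 2 by rewrite expr2; nra.
  have -> : K * t * t ^+ 2 = 27 * (K * (t ^+ 3 / 27)) by field.
  have -> : 27 * (N + 1) * t ^+ 2 = 27 * (t ^+ 2 + N * t ^+ 2) by ring.
  have : t * (1 + N * t) = t + N * t ^+ 2 by ring.
  by move: cube => /[swap] ->; lra.
apply/andP; split.
  apply: le_trans (uv k); rewrite /u.
  have : N * t <= N * T by rewrite ler_pM2l.
  by rewrite /t in t0 *; lra.
by apply: le_trans (imax k) _; rewrite /t in tT; lra.
Qed.

End HullMass.

(** * Maximization over a box *)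

Section Maximum.
Local Open Scope classical_set_scope.

(** The extreme value theorem, with continuity given by a Lipschitz bound in the
    sup norm and with the location and the values kept as separate arguments.
    Internally they form one row vector, the location in entry [0]. *)
Lemma exists_max_on_box (R : realType) (n : nat) (G : R -> ('I_n -> R) -> R)
    (a b m C L : R) :
  a <= b -> m <= C -> 0 <= L ->
  (forall (th th' : R) (v v' : 'I_n -> R) (d : R), a <= th <= b -> a <= th' <= b ->
    (forall i, m <= v i <= C) -> (forall i, m <= v' i <= C) -> 0 <= d <= 2^-1 ->
    `|th - th'| <= d -> (forall i, `|v i - v' i| <= d) ->
    G th v - G th' v' <= d * L) ->
  exists th v, [/\ a <= th <= b, forall i, m <= v i <= C &
    forall th' v', a <= th' <= b -> (forall i, m <= v' i <= C) ->
      G th' v' <= G th v].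
Proof.
move=> ab mC L0 GL.
pose box (j : 'I_n.+1) : set R :=
  if unlift ord0 j is Some _ then `[m, C] else `[a, b].
pose K : set 'rV[R]_n.+1 := [set w | forall j, box j (w ord0 j)].
pose val (w : 'rV[R]_n.+1) (i : 'I_n) : R := w ord0 (lift ord0 i).
pose F (w : 'rV[R]_n.+1) : R := G (w ord0 ord0) (val w).
have Kth w : K w -> a <= w ord0 ord0 <= b.
  by move=> /(_ ord0); rewrite /box unlift_none/= in_itv.
have Kval w : K w -> forall i, m <= val w i <= C.
  by move=> Kw i; have := Kw (lift ord0 i); rewrite /box liftK/= in_itv.
have cK : compact K.
  by apply: rV_compact => j; rewrite /box; case: unlift => *; exact: segment_compact.
pose pt (th : R) (v : 'I_n -> R) : 'rV[R]_n.+1 :=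
  \row_j (if unlift ord0 j is Some i then v i else th).
have pt0 th v : pt th v ord0 ord0 = th by rewrite mxE unlift_none.
have ptv th v : val (pt th v) = v.
  by apply/funext => i; rewrite /val mxE liftK.
have Kpt th v : a <= th <= b -> (forall i, m <= v i <= C) -> K (pt th v).
  move=> thab vmC j; rewrite /box mxE.
  by case: unliftP => [i _|_] /=; rewrite in_itv/=.
have cF : {within K, continuous F}.
  apply/subspace_continuousP => w Kw; apply/cvgrPdist_le => e e0.
  pose d := Num.min 2^-1 (e / (L + 1)).
  have L1 : 0 < L + 1 by lra.
  have d0 : 0 < d by rewrite /d lt_min invr_gt0 ltr0n/= divr_gt0.
  have d1 : 0 <= d <= 2^-1 by rewrite (ltW d0) /d ge_min lexx.
  have dL : d * L <= e.
    have : d * (L + 1) <= e by rewrite -ler_pdivlMr// /d ge_min lexx orbT.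
    by move: d0; nra.
  rewrite near_withinE; apply: filterS (nbhsx_ballx w d d0) => w' [_ ww'] Kw'.
  have near j : `|w ord0 j - w' ord0 j| <= d by apply: ltW; exact: ww'.
  have near' j : `|w' ord0 j - w ord0 j| <= d by rewrite distrC.
  rewrite ler_distl lerBlDr -lerBlDl -(lerBlDl _ (F w')).
  apply/andP; split; apply: le_trans dL; apply: GL => //;
    by [exact: Kth|exact: Kval|move=> i; exact: near|move=> i; exact: near'].
have K0 : K !=set0.
  by exists (pt a (fun=> m)); apply: Kpt => [|i]; rewrite ?lexx ?ab ?mC.
have [w /set_mem Kw wmax] := compact_EVT_max K0 cK cF.
exists (w ord0 ord0), (val w); split; [exact: Kth|exact: Kval|].
move=> th v thab vmC.
by have := wmax _ (mem_set (Kpt _ _ thab vmC)); rewrite /F pt0 ptv.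
Qed.

End Maximum.

(** * The criterion *)

Section Likelihood.
Variable R : realType.

Definition distances (n : nat) (X : n.-tuple R) (theta : R) : 'I_n -> R :=
  fun i => `|tnth X i - theta|.

Lemma measurable_usc_translate (psi : R -> \bar R) (t : R) :
  upper_semicontinuous psi ->
  measurable_fun [set: R]%classic (fun x : R => psi (x - t)).
Proof.
move=> usc; apply: measurableT_comp; first exact: measurable_usc.
exact: measurable_funB.
Qed.

Lemma integral_exp_translate (psi : R -> \bar R) (t : R) :
  upper_semicontinuous psi ->
  (\int[@lebesgue_measure R]_x expeR (psi (x - t)%R) =
   \int[@lebesgue_measure R]_x expeR (psi x))%E.
Proof.
move=> usc; apply: (integral_translate (f := fun x => expeR (psi x))).
- exact: measurable_expeR_usc.
- by move=> x; exact: expeR_ge0.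
Qed.

(** An inequality only, because the hull may exceed [v] at the data. *)
Lemma penalized_mean_le_Psi_hull (n : nat) (X : n.-tuple R) (theta : R) (v : 'I_n -> R) :
  (0 < n)%N ->
  ((penalized_mean (distances X theta) v)%:E <=
   Psi X theta (hull (distances X theta) v))%E.
Proof.
move=> n0; set Y := distances X theta; set h := hull Y v.
have S : SC0 h by apply: (@SC0_hull _ _ _ _ (Ordinal n0)); exact: normr_ge0.
have [[_ fin _] usc _] := S.
have vh i : ((v i)%:E <= h (tnth X i - theta)%R)%E by exact: le_hull_knot.
pose v' i : R := fine (h (tnth X i - theta)).
have hv' i : h (tnth X i - theta) = (v' i)%:E.
  by rewrite fineK// fin_numElt fin andbT; apply: lt_le_trans (vh i); exact: ltNyr.
rewrite /Psi (integral_empirical (v := v')) ?integral_exp_translate//; last first.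
  exact: measurable_usc_translate.
rewrite -hull_massE -EFinB lee_fin lerB// ler_wpM2l// ?invr_ge0//.
by apply: ler_sum => i _; rewrite -lee_fin -hv'.
Qed.

(** The left alternative occurs when [psi] is [-oo] at some observation.
    Otherwise the location is clamped to [[a, b]] and [psi] is replaced by the
    hull of its values at the data. *)
Lemma Psi_le_penalized_mean (n : nat) (X : n.-tuple R) (a b theta : R)
    (psi : R -> \bar R) :
  (0 < n)%N -> a <= b -> (forall i, a <= tnth X i <= b) -> SC0 psi ->
  Psi X theta psi = -oo%E \/
  exists th v, a <= th <= b /\
    (Psi X theta psi <= (penalized_mean (distances X th) v)%:E)%E.
Proof.
move=> n0 ab Xab S; have [[_ fin _] usc _] := S.
have [[i psii]|allfin] := pselect (exists i, psi (tnth X i - theta) = -oo%E).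
  left; rewrite /Psi (integral_empiricalNy (i := i))//; exact: measurable_usc_translate.
right.
pose v i : R := fine (psi (tnth X i - theta)).
have psiv i : psi (tnth X i - theta) = (v i)%:E.
  rewrite fineK// fin_numE (lt_eqF (fin _)) andbT.
  by apply/negP => /eqP H; apply: allfin; exists i.
pose th := Num.max a (Num.min b theta).
have thab : a <= th <= b by rewrite /th le_max lexx/= ge_max ab ge_min lexx.
have closer i : `|tnth X i - th| <= `|tnth X i - theta|.
  have /andP[aX Xb] := Xab i.
  rewrite /th; case: (leP b theta) => bth.
    rewrite (max_idPr ab) !ler0_norm; lra.
  case: (leP a theta) => ath //.
  rewrite !ger0_norm; lra.
pose v' i : R := fine (psi (tnth X i - th)).
have vv' i : ((v i)%:E <= psi (tnth X i - th)%R)%E.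
  by rewrite -psiv; exact: SC0_nonincreasing S (closer i) (psiv i).
have psiv' i : psi (tnth X i - th) = (v' i)%:E.
  by rewrite fineK// fin_numElt fin andbT; apply: lt_le_trans (vv' i); exact: ltNyr.
exists th, v'; split => //.
rewrite /Psi (integral_empirical (v := v)) ?integral_exp_translate//; last first.
  exact: measurable_usc_translate.
rewrite EFinB leeB//.
  rewrite lee_fin ler_wpM2l// ?invr_ge0//.
  by apply: ler_sum => i _; rewrite -lee_fin -psiv'.
rewrite hull_massE; apply: ge0_le_integral => //.
- by move=> x _; exact: expeR_ge0.
- by apply: measurable_expeR_usc; exact: upper_semicontinuous_hull.
- exact: measurable_expeR_usc.
- move=> x _; rewrite lee_expeR; apply: hull_le_SC0 => // i; first exact: normr_ge0.
  by rewrite /distances -(SC0_normr _ S).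
Qed.

(** By the triangle inequality, no location is close to both of two distinct
    observations. *)
Lemma exists_large_distance (n : nat) (X : n.-tuple R) (i1 i2 : 'I_n) (theta : R) :
  exists j, `|tnth X i1 - tnth X i2| / 2 <= distances X theta j.
Proof.
have : `|tnth X i1 - tnth X i2| <= distances X theta i1 + distances X theta i2.
  by rewrite /distances (distrC (tnth X i2)); exact: ler_distD.
by case: (leP (distances X theta i1) (distances X theta i2)) => ? ?;
  [exists i2|exists i1]; lra.
Qed.

(** Coercivity confines the values to a box on which the continuous penalized
    mean has a maximum; the hull of the maximizing values is the estimator. *)
Lemma mle_between (n : nat) (X : n.-tuple R) (a b : R) (i1 i2 : 'I_n) :
  (forall i, a <= tnth X i <= b) -> tnth X i1 != tnth X i2 ->
  exists2 theta, a <= theta <= b & is_mle_location X theta.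
Proof.
move=> Xab X12.
have n0 : (0 < n)%N by exact: leq_ltn_trans (leq0n _) (ltn_ord i1).
have ab : a <= b by have /andP[] := Xab i1; exact: le_trans.
pose M := `|tnth X i1 - tnth X i2| / 2.
have M0 : 0 < M by rewrite divr_gt0// normr_gt0 subr_eq0.
pose G th v := penalized_mean (distances X th) v.
(* Any point would do as the reference: only what beats it is of interest. *)
pose F0 := G a (fun=> 0).
have dist0 th i : 0 <= distances X th i by exact: normr_ge0.
have spread th := exists_large_distance X i1 i2 th.
have [m [C coercive]] := penalized_mean_coercive F0 n0 M0.
have inbox th v : F0 <= G th v -> forall i, m <= v i <= C.
  by move=> H; exact: coercive (dist0 th) (spread th) H.
have mC : m <= C.
  by have /andP[] := inbox a (fun=> 0) (lexx _) i1; exact: le_trans.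
pose W := b - a; have W0 : 0 <= W by rewrite subr_ge0.
have distW th : a <= th <= b -> forall i, distances X th i <= W.
  move=> /andP[ath thb] i; have /andP[aX Xb] := Xab i.
  by rewrite /distances ler_norml /W; apply/andP; split; lra.
have [th [v [thab vmC vmax]]] : exists th v, [/\ a <= th <= b,
    forall i, m <= v i <= C & forall th' v', a <= th' <= b ->
    (forall i, m <= v' i <= C) -> G th' v' <= G th v].
  apply: (@exists_max_on_box _ _ _ _ _ _ _ (1 + 2 * expR C * (1 + 2 * W))) => //.
    by rewrite addr_ge0// !mulr_ge0// ?expR_ge0// addr_ge0// mulr_ge0.
  move=> th th' v v' d thab thab' vmC vmC' d01 thd vd.
  have dd i : `|distances X th i - distances X th' i| <= d.
    apply: le_trans (ler_dist_dist _ _) _; apply: le_trans thd.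
    by rewrite (_ : _ - _ - _ = - (th - th')) ?normrN//; ring.
  have meanle : n%:R^-1 * \sum_i v i - n%:R^-1 * \sum_i v' i <= d.
    rewrite -mulrBr -sumrB ler_pdivrMl ?ltr0n//.
    apply: le_trans (ler_sum _ (fun i _ => le_trans (ler_norm _) (vd i))) _.
    by rewrite sumr_const card_ord mulr_natl.
  have : hull_mass (distances X th') v' - hull_mass (distances X th) v <=
      d * (2 * expR C * (1 + 2 * W)).
    apply: hull_mass_lipschitz => //.
    - by move=> i; have /andP[] := vmC' i.
    - by move=> i; have /andP[] := vmC i.
    - exact: distW.
    - by move=> i; have := dd i; rewrite ler_distl => /andP[].
    - by move=> i; have := vd i; rewrite ler_distl => /andP[].
  rewrite /G /penalized_mean mulrDr mulr1; lra.
exists th => //; exists (hull (distances X th) v); split.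
  exact: (@SC0_hull _ _ _ _ (Ordinal n0)).
move=> th' psi' S'; apply: le_trans (penalized_mean_le_Psi_hull X th v n0).
have [->|[th2 [v2 [thab2 Hle]]]] := Psi_le_penalized_mean th' n0 ab Xab S'.
  exact: leNye.
apply: le_trans Hle _; rewrite lee_fin -/(G _ _) -/(G _ _).
(* Outside the box the penalized mean is below the reference value. *)
have [F0le|/ltW F0ge] := leP F0 (G th2 v2).
  by apply: vmax => //; exact: inbox F0le.
by apply: le_trans F0ge _; apply: vmax; [rewrite lexx|exact: (inbox a (fun=> 0) (lexx _))].
Qed.

Lemma order_statistic_bounds (n : nat) (X : n.-tuple R) (i : 'I_n) :
  order_statistic X 0 <= tnth X i <= order_statistic X n.-1.
Proof.
have sX : size (sort <=%R X) = n by rewrite size_sort size_tuple.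
have : tnth X i \in sort <=%R X by rewrite mem_sort mem_tnth.
move=> /(nthP 0)[k]; rewrite sX => kn <-.
have srt : sorted <=%R (sort <=%R X) by exact: sort_le_sorted.
have n0 : (0 < n)%N by exact: leq_ltn_trans kn.
apply/andP; split; apply: (sorted_leq_nth le_trans lexx) => //; rewrite ?inE ?sX ?prednK//.
by rewrite -ltnS prednK.
Qed.

Lemma nondegenerate_distinct (n : nat) (X : n.-tuple R) : (0 < n)%N ->
  ~ degenerate X -> exists i1 i2, tnth X i1 != tnth X i2.
Proof.
move=> n0; apply: contra_notP => H.
exists (tnth X (Ordinal n0)).
transitivity ((n%:R^-1)%:E * \sum_(k < n) (\d_(nth 0%R X k : measurableTypeR R)
  [set tnth X (Ordinal n0)]%classic : \bar R))%E; first by [].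
rewrite (eq_bigr (fun=> 1%:E)) => [|i _]; last first.
  rewrite diracE -(tnth_nth 0 X i) mem_set//=.
  by apply/eqP/negPn/negP => ne; apply: H; exists i, (Ordinal n0).
by rewrite sumEFin sumr_const card_ord -EFinM mulVf// pnatr_eq0 -lt0n.
Qed.

End Likelihood.

Theorem theorem3 (R : realType) (n : nat) (n_gt0 : (0 < n)%N)
    (X : n.-tuple R) (X_nondegenerate : ~ degenerate X) :
  (exists (theta : R) (psi : R -> \bar R), is_mle X theta psi) /\
  (forall theta : R, unique (is_mle_location X) theta ->
    theta \in `[order_statistic X 0, order_statistic X n.-1]) /\
  (~ (exists! theta : R, is_mle_location X theta) ->
    exists2 theta : R, is_mle_location X theta &
      theta \in `[order_statistic X 0, order_statistic X n.-1]).
Proof.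
have [i1 [i2 X12]] := nondegenerate_distinct n_gt0 X_nondegenerate.
have [theta theta_in mle] := mle_between (order_statistic_bounds X) X12.
split; first by case: mle => psi; exists theta, psi.
split=> [theta' [_ uniq]|_]; last by exists theta; rewrite ?in_itv.
by rewrite in_itv/= (uniq _ mle).
Qed.
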